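(* The $(\mathsf{cSet},\otimes,\square^0)$-enriched category $\mathsf{Graph}_{\square}$ of graphs is locally Kan; that is, for all graphs $G,H$, the morphism cubical set $\mathsf{Graph}_{\square}(G,H)=\mathrm{N}(\operatorname{hom}^{\otimes}(G,H))$ is a Kan complex.
   Context: Graphs. A graph is a (possibly infinite) simple undirected graph without loops; write $v\sim w$ if $v,w$ are equal or joined by an edge. A graph map $f\colon G\to H$ is a function on vertices such that $v\sim w$ implies $f(v)\sim f(w)$. The product $G\otimes H$ has as vertices the pairs $(v,w)$, with $(v,w)\sim(v',w')$ iff ($v=v'$ and $w\sim w'$) or ($w=w'$ and $v\sim v'$); $G^{\otimes n}$ is the $n$-fold product, and the unit is the one-vertex graph $I_0$. $I_1$ is the graph with two vertices $0,1$ joined by an edge; $I_\infty$ has vertex set $\mathbb{Z}$ and edges between $i$ and $i+1$. $\operatorname{hom}^{\otimes}(G,H)$ is the graph whose vertices are graph maps $G\to H$, with $f\sim g$ iff there is a graph map $G\otimes I_1\to H$ restricting to $f$ on $G\otimes\{0\}$ and to $g$ on $G\otimes\{1\}$; it is the internal hom for $\otimes$. Cubical sets. The box category $\square$ has objects the posets $[1]^n=\{0\le1\}^n$, $n\ge0$, with morphisms generated by: faces $\partial_{i,\varepsilon}\colon[1]^{n-1}\to[1]^n$ inserting $\varepsilon\in\{0,1\}$ in position $i$; degeneracies $\sigma_i\colon[1]^n\to[1]^{n-1}$ deleting the $i$-th coordinate; connections $\gamma_{i,0},\gamma_{i,1}\colon[1]^n\to[1]^{n-1}$ replacing $x_i,x_{i+1}$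 by their max and min respectively. $\mathsf{cSet}$ is the category of presheaves on $\square$; operators act on the right. $\square^n$ is the representable presheaf of $[1]^n$, and the geometric product $\otimes$ on $\mathsf{cSet}$ is the monoidal product, cocontinuous in each variable, extending $[1]^m\otimes[1]^n=[1]^{m+n}$, with unit $\square^0$. The open box $\sqcap^n_{i,\varepsilon}\subseteq\square^n$ ($n\ge1$, $1\le i\le n$) is the union of the images of all faces $\partial_{j,\eta}$, $(j,\eta)\ne(i,\varepsilon)$. A cubical set $X$ is a Kan complex if every map $\sqcap^n_{i,\varepsilon}\to X$ extends to $\square^n$. Nerve. A graph map $f\colon I_\infty^{\otimes n}\to G$ is stable in all directions if there is $M\ge0$ such that for every $i$, the value of $f$ is unchanged when a coordinate $v_i>M$ is replaced by $M$ and when a coordinate $v_i<-M$ is replaced by $-M$. $\mathrm{N}G$ is the cubical set with $(\mathrm{N}G)_n$ the set of such maps, where $f\partial_{i,\varepsilon}$ is obtained by setting the $i$-th coordinate of $f$ equal to $(2\varepsilon-1)M$ for $M$ as in the stability condition, $f\sigma_i(v_1,\dots,v_{n+1})=f(v_1,\dots,v_{i-1},v_{i+1},\dots,v_{n+1})$, and $f\gamma_{i,0}$, $f\gamma_{i,1}$ send $(v_1,\dots,v_{n+1})$ to $f(v_1,\dots,v_{i-1},\max(v_i,v_{i+1}),v_{i+2},\dots)$ and $f(v_1,\dots,v_{i-1},\min(v_i,v_{i+1}),v_{i+2},\dots)$ respectively. $\mathrm{N}$ is lax monoidal: $\mathrm{N}G\otimes\mathrm{N}H\to\mathrm{N}(G\otimes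 H)$ sends a pair of cubes $f\colon I_\infty^{\otimes k}\to G$, $g\colon I_\infty^{\otimes l}\to H$ to $f\otimes g\colon I_\infty^{\otimes k+l}\to G\otimes H$, and $\square^0\cong\mathrm{N}I_0$. Enrichment. $\mathsf{Graph}_{\square}$ is the $(\mathsf{cSet},\otimes,\square^0)$-enriched category with objects all graphs, morphism objects $\mathrm{N}(\operatorname{hom}^{\otimes}(G,H))$, composition $\mathrm{N}(\operatorname{hom}^{\otimes}(H,J))\otimes\mathrm{N}(\operatorname{hom}^{\otimes}(G,H))\to\mathrm{N}(\operatorname{hom}^{\otimes}(H,J)\otimes\operatorname{hom}^{\otimes}(G,H))\to\mathrm{N}(\operatorname{hom}^{\otimes}(G,J))$ induced by the lax monoidal structure and composition of graph maps, and identities $\square^0\cong\mathrm{N}I_0\to\mathrm{N}(\operatorname{hom}^{\otimes}(G,G))$ given by $\mathrm{id}_G$. An enriched category over $\mathsf{cSet}$ is locally Kan if all its morphism cubical sets are Kan complexes. *)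

(* Defs.v *)
From mathcomp Require Import all_boot all_order all_algebra.
From mathcomp Require Import boolp zify.

Set Implicit Arguments.
Unset Strict Implicit.
Unset Printing Implicit Defensive.
Import Order.TTheory GRing.Theory Num.Theory.

Local Open Scope ring_scope.

(** Coordinates are numbered from 0, so position i of the usual 1-based
    notation is the ordinal i - 1.  The operations are used both on the
    vertices of [1]^n (T = bool) and on those of Z^n (T = int). *)

Definition vec (T : Type) (n : nat) := 'I_n -> T.

Definition vleft T m n (v : vec T (m + n)) : vec T m := fun i => v (lshift n i).
Definition vright T m n (v : vec T (m + n)) : vec T n := fun i => v (rshift m i).
Definition vcat T m n (a : vec T m) (b : vec T n) : vec T (m + n) :=
  fun i => match split i with inl j => a j | inr j => b j end.

Definition vcast T m n (e : m = n) (v : vec T m) : vec T n :=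
  fun i => v (cast_ord (esym e) i).

Definition vset T n (i : 'I_n) (a : T) (v : vec T n) : vec T n :=
  fun j => if j == i then a else v j.

Definition vins T n (i : 'I_n.+1) (a : T) (v : vec T n) : vec T n.+1 :=
  fun j => if unlift i j is Some k then v k else a.

Definition vdel T n (i : 'I_n.+1) (v : vec T n.+1) : vec T n :=
  fun j => v (lift i j).

(* (v_0, ..., v_n) |-> (v_0, ..., op v_i v_(i+1), ..., v_n) *)
Definition vjoin T (op : T -> T -> T) n (i : 'I_n) (v : vec T n.+1) : vec T n :=
  fun j => let j0 := widen_ord (leqnSn n) j in let j1 := lift ord0 j in
  if (j < i)%N then v j0 else if j == i then op (v j0) (v j1) else v j1.

Lemma vcat_lshift T m n (a : vec T m) (b : vec T n) i :
  vcat a b (lshift n i) = a i.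
Proof. by rewrite /vcat (unsplitK (inl i)). Qed.

Lemma vcat_rshift T m n (a : vec T m) (b : vec T n) i :
  vcat a b (rshift m i) = b i.
Proof. by rewrite /vcat (unsplitK (inr i)). Qed.

Lemma vleft_cat T m n (a : vec T m) (b : vec T n) : vleft (vcat a b) = a.
Proof. by apply: funext => i; rewrite /vleft vcat_lshift. Qed.

Lemma vright_cat T m n (a : vec T m) (b : vec T n) : vright (vcat a b) = b.
Proof. by apply: funext => i; rewrite /vright vcat_rshift. Qed.

Lemma vcat_split T m n (v : vec T (m + n)) : vcat (vleft v) (vright v) = v.
Proof.
by apply: funext => i; case: (split_ordP i) => j ->;
  rewrite ?vcat_lshift ?vcat_rshift.
Qed.

Lemma vec0_eq T (v w : vec T 0) : v = w.
Proof. by apply: funext => -[]. Qed.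

Lemma vec_eta_ord T n (v : vec T n) (i j : 'I_n) : i = j :> nat -> v i = v j.
Proof. by move=> /val_inj ->. Qed.

Lemma vcat0l T n (a : vec T 0) (b : vec T n) : vcat a b = b.
Proof.
apply: funext => i; rewrite -[RHS](vcat_rshift a b).
by apply: vec_eta_ord.
Qed.

Lemma vins_at T n i a (v : vec T n) : vins i a v i = a.
Proof. by rewrite /vins unlift_none. Qed.

Lemma vins_lift T n i a (v : vec T n) k : vins i a v (lift i k) = v k.
Proof. by rewrite /vins liftK. Qed.

Lemma vins_eq T n (i : 'I_n.+1) a (v : vec T n) (j : 'I_n.+1) (k : 'I_n) :
  j = bump i k :> nat -> vins i a v j = v k.
Proof. by move=> e; rewrite (_ : j = lift i k) ?vins_lift //; exact: val_inj. Qed.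

Lemma vins_eqi T n (i : 'I_n.+1) a (v : vec T n) (j : 'I_n.+1) :
  j = i :> nat -> vins i a v j = a.
Proof. by move=> /val_inj ->; rewrite vins_at. Qed.

Lemma vjoin_lift T (op : T -> T -> T) n (i : 'I_n) (v : vec T n.+1) :
  idempotent_op op ->
  vjoin op i v = fun j => op (vdel (lift ord0 i) v j)
                             (vdel (widen_ord (leqnSn n) i) v j).
Proof.
move=> opxx; apply: funext => j; rewrite /vjoin /vdel.
case: (ltngtP j i) => [lt_ji|lt_ij|e_ij].
- rewrite -[LHS]opxx; congr op; apply: vec_eta_ord => /=; rewrite /bump /=; lia.
- rewrite (_ : (j == i) = false); last by apply/negbTE/eqP => e; rewrite e ltnn in lt_ij.
  rewrite -[LHS]opxx; congr op; apply: vec_eta_ord => /=; rewrite /bump /=; lia.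
- rewrite (_ : (j == i) = true); last by apply/eqP/val_inj.
  by congr op; apply: vec_eta_ord => /=; rewrite /bump /=; lia.
Qed.

Definition cube (n : nat) := vec bool n.

(* the join for e = false, i.e. e = 0, and the meet for e = true, i.e. e = 1 *)
Definition bconn (e : bool) : bool -> bool -> bool := if e then andb else orb.

Inductive boxmap : forall m n : nat, (cube m -> cube n) -> Prop :=
| boxmap_id n : @boxmap n n id
| boxmap_comp l m n (f : cube m -> cube n) (g : cube l -> cube m) :
    boxmap f -> boxmap g -> boxmap (f \o g)
| boxmap_face n (i : 'I_n.+1) (e : bool) : @boxmap n n.+1 (vins i e)
| boxmap_degen n (i : 'I_n.+1) : @boxmap n.+1 n (vdel i)
| boxmap_conn n (i : 'I_n) (e : bool) : @boxmap n.+1 n (vjoin (bconn e) i).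

Record box (m n : nat) := Box { bfun :> cube m -> cube n; bfunP : boxmap bfun }.

Lemma box_ext m n (p q : box m n) : (forall x, p x = q x) -> p = q.
Proof.
case: p q => [f pf] [g pg] /= /funext e; case: _ / e in pg *.
by congr Box; exact: Prop_irrelevance.
Qed.

Definition bid n : box n n := Box (boxmap_id n).
Definition bcomp l m n (p : box m n) (q : box l m) : box l n :=
  Box (boxmap_comp (bfunP p) (bfunP q)).
Definition bface n (i : 'I_n.+1) (e : bool) : box n n.+1 := Box (boxmap_face i e).
Definition bdegen n (i : 'I_n.+1) : box n.+1 n := Box (boxmap_degen i).
Definition bgamma n (i : 'I_n) (e : bool) : box n.+1 n := Box (boxmap_conn i e).

Lemma boxmap_cast m n (e : m = n) : boxmap (@vcast bool m n e).
Proof.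
case: n / e; rewrite (_ : vcast _ = id); first exact: boxmap_id.
by apply: funext => v; apply: funext => i; rewrite /vcast; congr (v _); exact: val_inj.
Qed.

Definition bcast m n (e : m = n) : box m n := Box (boxmap_cast e).

Lemma bconnxx e : idempotent_op (bconn e).
Proof. by case: e => -[]. Qed.

Lemma boxmap_mono m n (f : cube m -> cube n) : boxmap f ->
  forall x y : cube m, (forall i, x i -> y i) -> forall j, f x j -> f y j.
Proof.
elim=> {m n f} [//|l m n f g _ IHf _ IHg x y xy|n i e x y xy j|n i x y xy j|n i e x y xy j].
- exact/IHf/IHg.
- by rewrite /vins; case: unlift => // k; exact: xy.
- exact: xy.
- rewrite !vjoin_lift; try exact: bconnxx; rewrite /vdel.
  have := xy (lift (lift ord0 i) j); have := xy (lift (widen_ord (leqnSn n) i) j).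
  by case: e => /= h1 h2; [case/andP => /h2-> /h1-> | case/orP => [/h2->|/h1->//]; rewrite ?orbT].
Qed.

(* Flipping one input coordinate changes at most one output coordinate. *)
Lemma boxmap_flip m n (f : cube m -> cube n) : boxmap f ->
  forall x y i, (forall k, k != i -> x k = y k) ->
  f x = f y \/ exists j, forall k, k != j -> f x k = f y k.
Proof.
elim=> {m n f} [n x y i xy|l m n f g _ IHf _ IHg x y i xy|n i e x y i0 xy|n i x y i0 xy|n i e x y i0 xy].
- by right; exists i.
- by case: (IHg _ _ _ xy) => [/= ->|[j /IHf//]]; left.
- right; exists (lift i i0) => k; rewrite /vins; case: unliftP => // k' -> nk.
  by apply: xy; apply: contra nk => /eqP ->.
- case: (unliftP i i0) => [j ej|ej].
    right; exists j => k nk; apply: xy; rewrite ej; apply: contra nk => /eqP.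
    by move=> /lift_inj->.
  by left; apply: funext => k; apply: xy; rewrite ej eq_sym neq_lift.
- have lt_n : ((if i0 <= i then i0 : nat else i0.-1) < n)%N.
    by case: ifP; move: (ltn_ord i0) (ltn_ord i); lia.
  right; exists (Ordinal lt_n) => k nk.
  have nk' : (k : nat) <> (if (i0 <= i)%N then i0 : nat else i0.-1).
    by move=> ek; move/eqP: nk; apply; exact: val_inj.
  rewrite !vjoin_lift; try exact: bconnxx; rewrite /vdel.
  by congr (bconn e _ _); apply: xy; apply/eqP => /(congr1 val) /=;
     rewrite /bump /=; move: nk'; case: ifP; lia.
Qed.

Definition ftens m n m' n' (f : cube m -> cube m') (g : cube n -> cube n') :
  cube (m + n) -> cube (m' + n') :=
  fun x => vcat (f (vleft x)) (g (vright x)).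

Lemma boxmap_tensl m m' k (f : cube m -> cube m') :
  boxmap f -> boxmap (ftens f (@id (cube k))).
Proof.
elim=> {m m' f} [n|l m n f g _ IHf _ IHg|n i e|n i|n i e].
- rewrite (_ : ftens _ _ = id); first exact: boxmap_id.
  by apply: funext => x; exact: vcat_split.
- rewrite (_ : ftens _ _ = ftens f id \o ftens g id); first exact: boxmap_comp.
  by apply: funext => x; rewrite /ftens /= vleft_cat vright_cat.
- rewrite (_ : ftens _ _ =
    (vins (lshift k i : 'I_(n + k).+1) e : cube (n + k) -> cube (n.+1 + k))).
    exact: (@boxmap_face (n + k)).
  apply: funext => x; apply: funext => j; rewrite /ftens.
  case: (split_ordP (j : 'I_(n.+1 + k))) => j' ->.
    rewrite vcat_lshift; case: (unliftP i j') => [j''|] ->.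
      by rewrite vins_lift; symmetry; apply: (@vins_eq _ (n + k) _ _ _ _ (lshift k j'')).
    by rewrite vins_at; symmetry; apply: vins_eqi.
  rewrite vcat_rshift; symmetry; apply: (@vins_eq _ (n + k) _ _ _ _ (rshift n j')).
  by rewrite /= /bump; have := ltn_ord i; lia.
- rewrite (_ : ftens _ _ =
    (@vdel _ (n + k) (lshift k i) : cube (n.+1 + k) -> cube (n + k))).
    exact: (@boxmap_degen (n + k)).
  apply: funext => x; apply: funext => j; rewrite /ftens.
  case: (split_ordP j) => j' ->; rewrite ?vcat_lshift ?vcat_rshift;
    rewrite /vdel /vleft /vright; apply: vec_eta_ord => //=.
  by rewrite /bump; have := ltn_ord i; lia.
- rewrite (_ : ftens _ _ =
    (@vjoin _ (bconn e) (n + k) (lshift k i) : cube (n.+1 + k) -> cube (n + k))).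
    exact: (@boxmap_conn (n + k)).
  apply: funext => x; rewrite vjoin_lift; last exact: bconnxx.
  apply: funext => j; rewrite /ftens vjoin_lift; last exact: bconnxx.
  have lt_i := ltn_ord i.
  case: (split_ordP j) => j' ->; rewrite ?vcat_lshift ?vcat_rshift.
    by congr bconn; rewrite /vdel /vleft /vright;
      apply: vec_eta_ord.
  by rewrite -[LHS](bconnxx e); congr bconn; rewrite /vdel /vleft /vright;
      apply: vec_eta_ord; rewrite /= /bump; lia.
Qed.

Lemma boxmap_tensr m m' k (f : cube m -> cube m') :
  boxmap f -> boxmap (ftens (@id (cube k)) f).
Proof.
elim=> {m m' f} [n|l m n f g _ IHf _ IHg|n i e|n i|n i e].
- rewrite (_ : ftens _ _ = id); first exact: boxmap_id.
  by apply: funext => x; exact: vcat_split.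
- rewrite (_ : ftens _ _ = ftens id f \o ftens id g); first exact: boxmap_comp.
  by apply: funext => x; rewrite /ftens /= vleft_cat vright_cat.
- rewrite (_ : ftens _ _ = vcast (esym (addnS k n)) \o
                           vins (cast_ord (addnS k n) (rshift k i)) e).
    by apply: boxmap_comp; [exact: boxmap_cast | exact: boxmap_face].
  apply: funext => x; apply: funext => j; rewrite /ftens /= /vcast.
  case: (split_ordP j) => j' ->.
    rewrite vcat_lshift; symmetry; apply: (@vins_eq _ (k + n) _ _ _ _ (lshift n j')).
    by rewrite /= /bump; have := ltn_ord j'; lia.
  rewrite vcat_rshift; case: (unliftP i j') => [j''|] ->.
    rewrite vins_lift; symmetry; apply: (@vins_eq _ (k + n) _ _ _ _ (rshift k j'')).
    by rewrite /= /bump; lia.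
  by rewrite vins_at; symmetry; apply: vins_eqi.
- rewrite (_ : ftens _ _ = vdel (cast_ord (addnS k n) (rshift k i)) \o
                           vcast (addnS k n)).
    by apply: boxmap_comp; [exact: boxmap_degen | exact: boxmap_cast].
  apply: funext => x; apply: funext => j; rewrite /ftens /= /vcast.
  case: (split_ordP j) => j' ->; rewrite ?vcat_lshift ?vcat_rshift;
    rewrite /vdel /vleft /vright; apply: vec_eta_ord; rewrite /= /bump; have := ltn_ord j'; lia.
- rewrite (_ : ftens _ _ = vjoin (bconn e) (rshift k i) \o vcast (addnS k n)).
    by apply: boxmap_comp; [exact: boxmap_conn | exact: boxmap_cast].
  apply: funext => x; rewrite /= vjoin_lift; last exact: bconnxx.
  apply: funext => j; rewrite /ftens vjoin_lift; last exact: bconnxx.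
  case: (split_ordP j) => j' ->; have lt_j := ltn_ord j';
    rewrite ?vcat_lshift ?vcat_rshift.
    by rewrite -[LHS](bconnxx e); congr bconn; rewrite /vdel /vleft /vright;
      apply: vec_eta_ord;
      rewrite /= /bump /=; lia.
  by congr bconn; rewrite /vdel /vleft /vright;
      apply: vec_eta_ord; rewrite /= /bump /=; lia.
Qed.

Lemma boxmap_tens m n m' n' (f : cube m -> cube m') (g : cube n -> cube n') :
  boxmap f -> boxmap g -> boxmap (ftens f g).
Proof.
move=> bf bg; rewrite (_ : ftens f g = ftens f id \o ftens id g).
  by apply: boxmap_comp; [exact: boxmap_tensl | exact: boxmap_tensr].
by apply: funext => x; rewrite /ftens /= vleft_cat vright_cat.
Qed.

Definition btens m n m' n' (p : box m m') (q : box n n') : box (m + n) (m' + n') :=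
  Box (boxmap_tens (bfunP p) (bfunP q)).

Lemma btens_id m n : btens (bid m) (bid n) = bid (m + n).
Proof. by apply: box_ext => x; exact: vcat_split. Qed.

Lemma btens_comp l l' m m' n n' (p : box m n) (q : box l m)
    (p' : box m' n') (q' : box l' m') :
  btens (bcomp p q) (bcomp p' q') = bcomp (btens p p') (btens q q').
Proof. by apply: box_ext => x; rewrite /= /ftens vleft_cat vright_cat. Qed.

Definition bassoc l m n : box (l + m + n) (l + (m + n)) := bcast (esym (addnA l m n)).

Lemma vassoc_l T l m n (v : vec T (l + m + n)) :
  vleft (vleft v) = vleft (vcast (esym (addnA l m n)) v).
Proof. by apply: funext => j; rewrite /vleft /vcast; apply: vec_eta_ord. Qed.

Lemma vassoc_m T l m n (v : vec T (l + m + n)) :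
  vright (vleft v) = vleft (vright (vcast (esym (addnA l m n)) v)).
Proof. by apply: funext => j; rewrite /vleft /vright /vcast; apply: vec_eta_ord. Qed.

Lemma vassoc_r T l m n (v : vec T (l + m + n)) :
  vright v = vright (vright (vcast (esym (addnA l m n)) v)).
Proof.
by apply: funext => j; rewrite /vright /vcast; apply: vec_eta_ord; rewrite /= addnA.
Qed.

Lemma vcast_cat0 T n (a : vec T n) (b : vec T 0) : vcast (addn0 n) (vcat a b) = a.
Proof.
apply: funext => i; rewrite /vcast -[RHS](vcat_lshift a b); exact: vec_eta_ord.
Qed.

Lemma bassoc_nat l m n l' m' n' (p : box l l') (q : box m m') (r : box n n') :
  bcomp (bassoc l' m' n') (btens (btens p q) r) =
  bcomp (btens p (btens q r)) (bassoc l m n).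
Proof.
apply: box_ext => x; apply: funext => i; rewrite /= /vcast /ftens.
rewrite vassoc_l vassoc_m vassoc_r.
case: (split_ordP i) => [j ->|j]; last case: (split_ordP j) => [k -> ->|k -> ->].
- rewrite [RHS]vcat_lshift.
  rewrite (_ : cast_ord _ _ = lshift n' (lshift m' j)) ?vcat_lshift //; exact: val_inj.
- rewrite [RHS]vcat_rshift [RHS]vcat_lshift.
  rewrite (_ : cast_ord _ _ = lshift n' (rshift l' k)) ?vcat_lshift ?vcat_rshift //.
  exact: val_inj.
- rewrite [RHS]vcat_rshift [RHS]vcat_rshift.
  rewrite (_ : cast_ord _ _ = rshift (l' + m') k) ?vcat_rshift //.
  by apply: val_inj; rewrite /= addnA.
Qed.

Record cset := CSet {
  cells :> nat -> Type;
  act : forall m n : nat, box m n -> cells n -> cells m;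
  act_id : forall n (x : cells n), act (bid n) x = x;
  act_comp : forall l m n (p : box m n) (q : box l m) (x : cells n),
    act (bcomp p q) x = act q (act p x) }.

Arguments act {X m n} p x : rename.

Record cmap (X Y : cset) := CMap {
  cfun :> forall n, X n -> Y n;
  cfunP : forall m n (p : box m n) (x : X n), cfun (act p x) = act p (cfun x) }.

Lemma cmap_ext X Y (f g : cmap X Y) : (forall n (x : X n), f n x = g n x) -> f = g.
Proof.
case: f g => [f pf] [g pg] /= fg.
have e : f = g by apply: functional_extensionality_dep => n; apply: funext.
by case: _ / e in pg fg *; congr CMap; exact: Prop_irrelevance.
Qed.

Definition cmap_id X : cmap X X :=
  @CMap X X (fun n x => x) (fun m n p x => erefl).

Fact cmap_comp_subproof X Y Z (g : cmap Y Z) (f : cmap X Y) m n (p : box m n) x :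
  g m (f m (act p x)) = act p (g n (f n x)).
Proof. by rewrite !cfunP. Qed.

Definition cmap_comp X Y Z (g : cmap Y Z) (f : cmap X Y) : cmap X Z :=
  @CMap X Z (fun n x => g n (f n x)) (@cmap_comp_subproof X Y Z g f).

Lemma cmap_idE (X : cset) n (x : X n) : cmap_id X n x = x.
Proof. by []. Qed.

Lemma cmap_compE (X Y Z : cset) (g : cmap Y Z) (f : cmap X Y) n (x : X n) :
  cmap_comp g f n x = g n (f n x).
Proof. by []. Qed.

Fact repr_act_id n m (x : box m n) : bcomp x (bid m) = x.
Proof. exact: box_ext. Qed.

Fact repr_act_comp n k l m (p : box l m) (q : box k l) (x : box m n) :
  bcomp x (bcomp p q) = bcomp (bcomp x p) q.
Proof. exact: box_ext. Qed.

Definition repr (n : nat) : cset :=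
  @CSet (fun m => box m n) (fun l m p x => bcomp x p)
        (@repr_act_id n) (@repr_act_comp n).

Definition in_open_box n (i : 'I_n.+1) (e : bool) m (p : box m n.+1) : Prop :=
  exists (j : 'I_n.+1) (d : bool) (q : box m n),
    (j, d) <> (i, e) /\ p = bcomp (bface j d) q.

Definition open_box_cell n (i : 'I_n.+1) (e : bool) (m : nat) : Type :=
  {p : box m n.+1 | in_open_box i e p}.

Fact open_box_closed n (i : 'I_n.+1) e l m (q : box l m) (p : open_box_cell i e m) :
  in_open_box i e (bcomp (sval p) q).
Proof.
case: p => p /= [j [d [r [ne ->]]]].
by exists j, d, (bcomp r q); split=> //; exact: box_ext.
Qed.

Definition open_box_act n (i : 'I_n.+1) e l m (q : box l m)
    (p : open_box_cell i e m) : open_box_cell i e l :=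
  exist _ (bcomp (sval p) q) (open_box_closed q p).

Lemma open_box_ext n (i : 'I_n.+1) e m (p q : open_box_cell i e m) :
  sval p = sval q -> p = q.
Proof.
case: p q => p pP [q qP] /= e0; case: _ / e0 in qP *.
by congr exist; exact: Prop_irrelevance.
Qed.

Fact open_box_act_id n (i : 'I_n.+1) e m (p : open_box_cell i e m) :
  open_box_act (bid m) p = p.
Proof. by apply: open_box_ext; exact: box_ext. Qed.

Fact open_box_act_comp n (i : 'I_n.+1) e k l m (q : box l m) (r : box k l)
    (p : open_box_cell i e m) :
  open_box_act (bcomp q r) p = open_box_act r (open_box_act q p).
Proof. by apply: open_box_ext; exact: box_ext. Qed.

Definition open_box n (i : 'I_n.+1) (e : bool) : cset :=
  @CSet (open_box_cell i e) (@open_box_act n i e)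
        (@open_box_act_id n i e) (@open_box_act_comp n i e).

Definition open_box_incl n (i : 'I_n.+1) (e : bool) :
  cmap (open_box i e) (repr n.+1) :=
  @CMap (open_box i e) (repr n.+1) (fun m p => sval p) (fun l m q p => erefl).

Definition kan (X : cset) : Prop :=
  forall n (i : 'I_n.+1) (e : bool) (h : cmap (open_box i e) X),
  exists g : cmap (repr n.+1) X, cmap_comp g (open_box_incl i e) = h.

(** [tensor X Y] is Day convolution: the coend of
    X_m * Y_n * Box([1]^k, [1]^(m+n)) over m and n, as a quotient by the
    equivalence relation [teq].  Maps out of it are the [bimap]s. *)

Record tcell (X Y : cset) (k : nat) := TCell {
  tdimL : nat; tdimR : nat;
  tcellL : X tdimL; tcellR : Y tdimR;
  tcellB : box k (tdimL + tdimR) }.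

Inductive teq (X Y : cset) (k : nat) : tcell X Y k -> tcell X Y k -> Prop :=
| teq_refl a : teq a a
| teq_sym a b : teq a b -> teq b a
| teq_trans a b c : teq a b -> teq b c -> teq a c
| teq_step m n m' n' (p : box m m') (q : box n n') (x : X m') (y : Y n')
    (r : box k (m + n)) :
    teq (TCell (act p x) (act q y) r) (TCell x y (bcomp (btens p q) r)).

Definition tensor_cell (X Y : cset) (k : nat) : Type :=
  {P : tcell X Y k -> Prop | exists a, P = teq a}.

Definition tclass X Y k (a : tcell X Y k) : tensor_cell X Y k :=
  exist _ (teq a) (ex_intro _ a erefl).

Definition trepr X Y k (c : tensor_cell X Y k) : tcell X Y k := projT1 (cid (svalP c)).

Lemma treprK X Y k : cancel (@trepr X Y k) (@tclass X Y k).
Proof.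
move=> [P PP]; rewrite /trepr /=; case: (cid _) => a /= e; rewrite /tclass.
by case: _ / (esym e) in PP *; congr exist; exact: Prop_irrelevance.
Qed.

Lemma tclass_eq X Y k (a b : tcell X Y k) : teq a b -> tclass a = tclass b.
Proof.
move=> ab; have e : teq a = teq b.
  apply: funext => c; apply: propext; split; apply: teq_trans => //.
  exact: teq_sym.
rewrite /tclass; move: (ex_intro _ a _) (ex_intro _ b _); case: _ / e => h h'.
by congr exist; exact: Prop_irrelevance.
Qed.

Lemma teq_tclass X Y k (a b : tcell X Y k) : tclass a = tclass b -> teq a b.
Proof. by move=> /(congr1 sval) /= ->; exact: teq_refl. Qed.

Lemma teq_trepr X Y k (a : tcell X Y k) : teq (trepr (tclass a)) a.
Proof. by apply: teq_tclass; rewrite treprK. Qed.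

Definition tcell_act X Y k l (p : box l k) (a : tcell X Y k) : tcell X Y l :=
  TCell (tcellL a) (tcellR a) (bcomp (tcellB a) p).

Lemma teq_act X Y k l (p : box l k) (a b : tcell X Y k) :
  teq a b -> teq (tcell_act p a) (tcell_act p b).
Proof.
elim=> {a b} [a|a b _|a b c _ ab _|m n m' n' q r x y s].
- exact: teq_refl.
- exact: teq_sym.
- exact: teq_trans.
- rewrite /tcell_act /=.
  rewrite (_ : bcomp (bcomp _ s) p = bcomp (btens q r) (bcomp s p)); last exact: box_ext.
  exact: teq_step.
Qed.

Definition tensor_act X Y l k (p : box l k) (c : tensor_cell X Y k) :
  tensor_cell X Y l := tclass (tcell_act p (trepr c)).

Lemma tensor_actE X Y k l (p : box l k) (a : tcell X Y k) :
  tensor_act p (tclass a) = tclass (tcell_act p a).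
Proof. by apply: tclass_eq; apply: teq_act; exact: teq_trepr. Qed.

Fact tensor_act_id X Y k (c : tensor_cell X Y k) : tensor_act (bid k) c = c.
Proof.
rewrite -[c]treprK tensor_actE; case: (trepr c) => m n x y r; rewrite /tcell_act /=.
by rewrite (_ : bcomp r _ = r) //; exact: box_ext.
Qed.

Fact tensor_act_comp X Y j k l (p : box k l) (q : box j k) (c : tensor_cell X Y l) :
  tensor_act (bcomp p q) c = tensor_act q (tensor_act p c).
Proof.
rewrite -[c]treprK !tensor_actE; case: (trepr c) => m n x y r; rewrite /tcell_act /=.
by rewrite (_ : bcomp r _ = bcomp (bcomp r p) q) //; exact: box_ext.
Qed.

Definition tensor (X Y : cset) : cset :=
  @CSet (tensor_cell X Y) (@tensor_act X Y) (@tensor_act_id X Y) (@tensor_act_comp X Y).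

Record bimap (X Y Z : cset) := BiMap {
  bimap_fun :> forall m n, X m -> Y n -> Z (m + n)%N;
  bimapP : forall m n m' n' (p : box m m') (q : box n n') (x : X m') (y : Y n'),
    bimap_fun (act p x) (act q y) = act (btens p q) (bimap_fun x y) }.

Definition tpair_fun (X Y : cset) m n (x : X m) (y : Y n) : tensor X Y (m + n)%N :=
  tclass (TCell x y (bid (m + n))).

Fact tpair_nat (X Y : cset) m n m' n' (p : box m m') (q : box n n') (x : X m') (y : Y n') :
  tpair_fun (act p x) (act q y) = act (btens p q) (tpair_fun x y).
Proof.
rewrite /tpair_fun /= tensor_actE; apply: tclass_eq.
apply: teq_trans (teq_step _ _ _ _ _) _; rewrite /tcell_act /=.
rewrite (_ : bcomp _ _ = bcomp (bid _) (btens p q)); last exact: box_ext.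
exact: teq_refl.
Qed.

Definition tpair X Y : bimap X Y (tensor X Y) := BiMap (@tpair_nat X Y).

Lemma tensor_ind X Y k (c : tensor X Y k) :
  exists m n (x : X m) (y : Y n) (r : box k (m + n)), c = act r (tpair X Y _ _ x y).
Proof.
rewrite -[c]treprK; case: (trepr c) => m n x y r; exists m, n, x, y, r.
rewrite /= /tpair_fun tensor_actE /tcell_act /=.
by congr (tclass (TCell _ _ _)); exact: box_ext.
Qed.

Lemma tensor_ext X Y Z (f g : cmap (tensor X Y) Z) :
  (forall m n (x : X m) (y : Y n), f _ (tpair X Y _ _ x y) = g _ (tpair X Y _ _ x y)) ->
  f = g.
Proof.
move=> fg; apply: cmap_ext => k c.
by have [m [n [x [y [r ->]]]]] := tensor_ind c; rewrite !cfunP fg.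
Qed.

Definition tensor_rec_fun X Y Z (b : bimap X Y Z) k (c : tensor X Y k) : Z k :=
  act (tcellB (trepr c)) (b _ _ (tcellL (trepr c)) (tcellR (trepr c))).

Lemma tensor_rec_funE X Y Z (b : bimap X Y Z) k (a : tcell X Y k) :
  tensor_rec_fun b (tclass a) = act (tcellB a) (b _ _ (tcellL a) (tcellR a)).
Proof.
rewrite /tensor_rec_fun; move: (teq_trepr a).
move: (trepr _) => a0; elim=> {a a0} //= [a1 a2 a3 _ -> _ ->|] //.
by move=> m n m' n' p q x y r; rewrite bimapP -act_comp.
Qed.

Fact tensor_rec_nat X Y Z (b : bimap X Y Z) k l (p : box k l) (c : tensor X Y l) :
  tensor_rec_fun b (act p c) = act p (tensor_rec_fun b c).
Proof.
rewrite -[c]treprK /= tensor_actE !tensor_rec_funE /=; exact: act_comp.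
Qed.

Definition tensor_rec X Y Z (b : bimap X Y Z) : cmap (tensor X Y) Z :=
  CMap (@tensor_rec_nat X Y Z b).

Lemma tensor_recE X Y Z (b : bimap X Y Z) m n (x : X m) (y : Y n) :
  tensor_rec b _ (tpair X Y _ _ x y) = b _ _ x y.
Proof. by rewrite /= tensor_rec_funE act_id. Qed.

Fact tensor_map_subproof X Y X' Y' (f : cmap X X') (g : cmap Y Y')
    m n m' n' (p : box m m') (q : box n n') (x : X m') (y : Y n') :
  tpair X' Y' _ _ (f m (act p x)) (g n (act q y)) =
  act (btens p q) (tpair X' Y' _ _ (f m' x) (g n' y)).
Proof. by rewrite !cfunP bimapP. Qed.

Definition tensor_map X Y X' Y' (f : cmap X X') (g : cmap Y Y') :
  cmap (tensor X Y) (tensor X' Y') :=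
  tensor_rec (BiMap (@tensor_map_subproof X Y X' Y' f g)).

Definition tassoc_cell (X Y W : cset) k l m n (x : X m) (y : Y n)
    (r : box k (m + n)) (w : W l) : tensor X (tensor Y W) (k + l)%N :=
  act (bcomp (bassoc m n l) (btens r (bid l)))
      (tpair X (tensor Y W) _ _ x (tpair Y W _ _ y w)).

Lemma tassoc_cell_step (X Y W : cset) k l m n m' n' (p : box m m') (q : box n n')
    (x : X m') (y : Y n') (r : box k (m + n)) (w : W l) :
  tassoc_cell (act p x) (act q y) r w = tassoc_cell x y (bcomp (btens p q) r) w.
Proof.
rewrite /tassoc_cell -[w in LHS]act_id !bimapP -act_comp; congr (act _ _).
rewrite -[bid l in RHS](_ : bcomp (bid l) (bid l) = bid l); last exact: box_ext.
rewrite btens_comp; apply: box_ext => v.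
have /(congr1 (fun b => bfun b (btens r (bid l) v))) := bassoc_nat p q (bid l).
exact: esym.
Qed.

Lemma tassoc_cell_act (X Y W : cset) k l k' l' m n (p : box k' k) (q : box l' l)
    (x : X m) (y : Y n) (r : box k (m + n)) (w : W l) :
  tassoc_cell x y (bcomp r p) (act q w) = act (btens p q) (tassoc_cell x y r w).
Proof.
rewrite /tassoc_cell -[y in LHS]act_id bimapP -[x in LHS]act_id bimapP.
rewrite -!act_comp; congr (act _ _); apply: box_ext => v /=.
have /(congr1 (fun b => bfun b (btens (bcomp r p) (bid l') v))) :=
  bassoc_nat (bid m) (bid n) q.
move=> /= <-; congr (vcast _ _).
by rewrite /ftens /= !vleft_cat !vright_cat vcat_split.
Qed.

(* ((x, y), w) |-> (x, (y, w)) *)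
Definition tassoc_fun (X Y W : cset) k l (c : tensor X Y k) (w : W l) :
    tensor X (tensor Y W) (k + l)%N :=
  tassoc_cell (tcellL (trepr c)) (tcellR (trepr c)) (tcellB (trepr c)) w.

Lemma tassoc_funE (X Y W : cset) k l (a : tcell X Y k) (w : W l) :
  tassoc_fun (tclass a : tensor X Y k) w =
  tassoc_cell (tcellL a) (tcellR a) (tcellB a) w.
Proof.
rewrite /tassoc_fun; move: (teq_trepr a).
move: (trepr _) => a0; elim=> {a a0} [|||m n m' n' p q x y r] //=.
  by move=> a1 a2 a3 _ -> _ ->.
exact: tassoc_cell_step.
Qed.

Fact tassoc_nat (X Y W : cset) k l k' l' (p : box k k') (q : box l l')
    (c : tensor X Y k') (w : W l') :
  tassoc_fun (act p c) (act q w) = act (btens p q) (tassoc_fun c w).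
Proof.
rewrite -[c]treprK [act p _]tensor_actE !tassoc_funE; exact: tassoc_cell_act.
Qed.

Definition tassoc (X Y W : cset) :
    cmap (tensor (tensor X Y) W) (tensor X (tensor Y W)) :=
  tensor_rec (BiMap (@tassoc_nat X Y W)).

Fact tunitl_nat (X : cset) m n m' n' (p : box m m') (q : box n n')
    (u : repr 0 m') (x : X n') :
  act (btens (act p u) (bid n)) (act q x : X (0 + n)%N) =
  act (btens p q) (act (btens u (bid n')) (x : X (0 + n')%N)).
Proof.
rewrite -!act_comp; congr (act _ _); apply: box_ext => v.
by rewrite /= /ftens !vcat0l vright_cat.
Qed.

(* (u, x) |-> x, restricted along the projection [1]^(m+n) -> [1]^n *)
Definition tunitl (X : cset) : cmap (tensor (repr 0) X) X :=
  tensor_rec (BiMap (@tunitl_nat X)).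

Fact tunitr_nat (X : cset) m n m' n' (p : box m m') (q : box n n')
    (x : X m') (u : repr 0 n') :
  act (bcomp (bcast (addn0 m)) (btens (bid m) (act q u))) (act p x) =
  act (btens p q) (act (bcomp (bcast (addn0 m')) (btens (bid m') u)) x).
Proof.
rewrite -!act_comp; congr (act _ _); apply: box_ext => v /=.
by rewrite /ftens /= !vcast_cat0 vleft_cat.
Qed.

Definition tunitr (X : cset) : cmap (tensor X (repr 0)) X :=
  tensor_rec (BiMap (@tunitr_nat X)).

Record ecat := ECat {
  eobj :> Type;
  ehom : eobj -> eobj -> cset;
  ecomp : forall x y z, cmap (tensor (ehom y z) (ehom x y)) (ehom x z);
  eid : forall x, cmap (repr 0) (ehom x x);
  ecompA : forall w x y z,
    cmap_comp (ecomp w x z) (tensor_map (ecomp x y z) (cmap_id (ehom w x))) =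
    cmap_comp (cmap_comp (ecomp w y z)
                         (tensor_map (cmap_id (ehom y z)) (ecomp w x y)))
              (tassoc (ehom y z) (ehom x y) (ehom w x));
  ecomp1l : forall x y,
    cmap_comp (ecomp x y y) (tensor_map (eid y) (cmap_id (ehom x y))) =
    tunitl (ehom x y);
  ecomp1r : forall x y,
    cmap_comp (ecomp x x y) (tensor_map (cmap_id (ehom x y)) (eid x)) =
    tunitr (ehom x y) }.

Definition locally_kan (C : ecat) : Prop := forall x y : C, kan (ehom x y).

Record graph := Graph {
  vert :> Type;
  edge : vert -> vert -> Prop;
  edge_sym : forall v w, edge v w -> edge w v;
  edge_irr : forall v, ~ edge v v }.

(* v ~ w *)
Definition adj (G : graph) (v w : G) : Prop := v = w \/ edge v w.

Lemma adj_refl (G : graph) (v : G) : adj v v.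
Proof. by left. Qed.

Lemma adj_sym (G : graph) (v w : G) : adj v w -> adj w v.
Proof. by case=> [->|/edge_sym]; [left | right]. Qed.

Definition graph_of (V : Type) (r : V -> V -> Prop)
    (r_sym : forall v w, r v w -> r w v) : graph :=
  @Graph V (fun v w => v <> w /\ r v w)
    (fun v w vw => conj (not_eq_sym vw.1) (r_sym v w vw.2))
    (fun v vv => vv.1 erefl).

Lemma adj_graph_of V r (r_sym : forall v w : V, r v w -> r w v) :
  (forall v, r v v) -> forall v w, @adj (graph_of r_sym) v w <-> r v w.
Proof.
move=> r_refl v w; split=> [[->|[]]//|vw].
by case: (pselect (v = w)) => [->|ne]; [left | right].
Qed.

Record gmap (G H : graph) := GMap {
  gfun :> G -> H;
  gfunP : forall v w, adj v w -> adj (gfun v) (gfun w) }.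

Lemma gmap_ext G H (f g : gmap G H) : (forall v, f v = g v) -> f = g.
Proof.
case: f g => [f pf] [g pg] /= /funext e; case: _ / e in pg *.
by congr GMap; exact: Prop_irrelevance.
Qed.

Definition gid (G : graph) : gmap G G := @GMap G G (fun v => v) (fun v w vw => vw).
Definition gcomp (G H J : graph) (g : gmap H J) (f : gmap G H) : gmap G J :=
  @GMap G J (fun v => g (f v)) (fun v w vw => gfunP g (gfunP f vw)).

Definition prod_rel (G H : graph) (p q : G * H) : Prop :=
  (p.1 = q.1 /\ adj p.2 q.2) \/ (p.2 = q.2 /\ adj p.1 q.1).

Fact prod_rel_sym (G H : graph) (p q : G * H) : prod_rel p q -> prod_rel q p.
Proof. by case=> -[e /adj_sym a]; [left | right]. Qed.

Definition gprod (G H : graph) : graph := graph_of (@prod_rel_sym G H).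

Lemma adj_gprod (G H : graph) (p q : gprod G H) : adj p q <-> prod_rel p q.
Proof. by apply: adj_graph_of => v; left; split=> //; exact: adj_refl. Qed.

Definition I0 : graph :=
  @Graph unit (fun _ _ => False) (fun _ _ h => h) (fun _ h => h).

(* false and true stand for the vertices 0 and 1 *)
Definition I1 : graph :=
  @Graph bool (fun x y => x <> y) (fun _ _ => @not_eq_sym _ _ _) (fun _ h => h erefl).

Fact Iinf_irr (i : int) : ~ (i = i + 1 \/ i = i + 1).
Proof. lia. Qed.

Definition Iinf : graph :=
  @Graph int (fun i j => j = i + 1 \/ i = j + 1)
    (fun _ _ => proj1 (or_comm _ _)) Iinf_irr.

(* The n-fold product of G with itself, on vectors instead of nested pairs. *)
Definition pow_rel (G : graph) n (v w : vec G n) : Prop :=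
  v = w \/ exists i, adj (v i) (w i) /\ forall j, j != i -> v j = w j.

Fact pow_rel_sym (G : graph) n (v w : vec G n) : pow_rel v w -> pow_rel w v.
Proof.
case=> [->|[i [/adj_sym vw e]]]; first by left.
by right; exists i; split=> // j /e.
Qed.

Definition gpow (G : graph) (n : nat) : graph := graph_of (@pow_rel_sym G n).

Lemma adj_gpow (G : graph) n (v w : gpow G n) : adj v w <-> pow_rel v w.
Proof. by apply: adj_graph_of => ?; left. Qed.

Lemma gpow_succ (G : graph) n (v w : vec G n.+1) :
  @adj (gpow G n.+1) v w <->
  @adj (gprod G (gpow G n)) (v ord0, vdel ord0 v) (w ord0, vdel ord0 w).
Proof.
have vw_eq : v ord0 = w ord0 -> vdel ord0 v = vdel ord0 w -> v = w.
  move=> e0 e1; apply: funext => i; case: (unliftP ord0 i) => [j|] -> //.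
  exact: (congr1 (fun u : vec _ _ => u j) e1).
rewrite adj_gpow adj_gprod /prod_rel /= adj_gpow; split.
- case=> [->|[i]]; first by left; split=> //; left.
  case: (unliftP ord0 i) => [j|] -> [a e].
    left; split; first by apply: e; rewrite neq_lift.
    right; exists j; split=> // k nk; apply: e; apply: contra nk.
    by move=> /eqP/lift_inj->.
  by right; split=> //; apply: funext => k; apply: e; rewrite eq_sym neq_lift.
- case=> [[e0 [/vw_eq ->//|[j [a e]]]]|[e1 a]]; first by left.
    right; exists (lift ord0 j); split=> // k.
    case: (unliftP ord0 k) => [k'|] -> // nk; apply: e; apply: contra nk.
    by move=> /eqP->.
  right; exists ord0; split=> // k; case: (unliftP ord0 k) => [k'|] ->.
    by move=> _; exact: (congr1 (fun u : vec _ _ => u k') e1).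
  by rewrite eqxx.
Qed.

Definition hom_rel (G H : graph) (f g : gmap G H) : Prop :=
  exists K : gmap (gprod G I1) H,
    (forall v, K (v, false) = f v) /\ (forall v, K (v, true) = g v).

Fact swap_adj (G : graph) (p q : gprod G I1) :
  adj p q -> @adj (gprod G I1) (p.1, ~~ p.2) (q.1, ~~ q.2).
Proof.
rewrite !adj_gprod /prod_rel /= => -[[e a]|[-> a]]; [left | by right].
by split=> //; case: a => [->|ne]; [left | right => /negb_inj].
Qed.

Fact hom_rel_sym (G H : graph) (f g : gmap G H) : hom_rel f g -> hom_rel g f.
Proof.
move=> [K [K0 K1]].
by exists (gcomp K (GMap (@swap_adj G))); split=> v /=; rewrite ?K0 ?K1.
Qed.

Definition ghom (G H : graph) : graph := graph_of (@hom_rel_sym G H).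

Lemma hom_relP (G H : graph) (f g : gmap G H) :
  hom_rel f g <-> forall v, adj (f v) (g v).
Proof.
split=> [[K [K0 K1]] v|fg].
  by rewrite -K0 -K1; apply: gfunP; apply/adj_gprod; left; split=> //; right.
have KP (p q : gprod G I1) : adj p q ->
    adj (if p.2 then g p.1 else f p.1) (if q.2 then g q.1 else f q.1).
  case: p q => [v a] [w b] /adj_gprod[] /= [<-].
    by case: a b => [] [] _; try exact: adj_refl; [apply: adj_sym|].
  by case: a => /gfunP.
by exists (GMap KP).
Qed.

Lemma adj_ghom (G H : graph) (f g : ghom G H) : adj f g <-> forall v, adj (f v) (g v).
Proof.
rewrite -hom_relP; apply: adj_graph_of => h; apply/hom_relP => v; exact: adj_refl.
Qed.

Definition stable (G : graph) n (f : gmap (gpow Iinf n) G) (M : nat) : Prop :=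
  forall (v : vec int n) (i : 'I_n),
    (M%:Z < v i -> f (vset i M%:Z v) = f v) /\
    (v i < - M%:Z -> f (vset i (- M%:Z) v) = f v).

Record ncube (G : graph) (n : nat) := NCube {
  ngmap :> gmap (gpow Iinf n) G;
  ncubeP : exists M, stable ngmap M }.

Lemma ncube_ext G n (f g : ncube G n) :
  (forall v : vec int n, f v = g v) -> f = g.
Proof.
case: f g => [f pf] [g pg] /= fg.
have e : f = g := @gmap_ext (gpow Iinf n) G f g fg.
case: _ / e in pg fg *.
by congr NCube; exact: Prop_irrelevance.
Qed.

(* The extension of a map of cubes phi : [1]^m -> [1]^n to a map Z^m -> Z^n with
   values in [-M, M]: coordinate j of phi, a monotone Boolean function, is a
   lattice polynomial (the join, over the A on which it holds, of the meets of
   the variables in A), which is evaluated in the lattice [-M, M].  The lemmas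
   [nact_face], [nact_degen] and [nact_conn] below give the resulting action on
   the generators of the box category. *)
Definition latext m n (phi : cube m -> cube n) (M : nat) (v : vec int m) :
    vec int n :=
  fun j => \big[Num.max/- M%:Z]_(A : {set 'I_m} | phi (fun i => i \in A) j)
             \big[Num.min/M%:Z]_(i in A) v i.

Definition thr m (t : int) (v : vec int m) : cube m := fun i => t <= v i.

Lemma latext_bound m n (phi : cube m -> cube n) M v j :
  - M%:Z <= latext phi M v j <= M%:Z.
Proof.
apply/andP; split; first exact: bigmax_ge_id.
by apply/bigmax_leP; split=> [|A _]; [lia | exact: bigmin_le_id].
Qed.

Lemma thr_latext m n (phi : cube m -> cube n) (M : nat) v t j : boxmap phi ->
  - M%:Z < t <= M%:Z -> thr t (latext phi M v) j = phi (thr t v) j.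
Proof.
move=> phiP /andP[Mt tM]; rewrite /thr; apply/idP/idP.
- apply: contraTT; rewrite -ltNge => nphi; apply/bigmax_ltP; split=> // A phiA.
  rewrite ltNge; apply: contra nphi => /bigmin_geP[_ tA].
  by apply: (boxmap_mono phiP) phiA => i /tA.
- move=> phit; pose A := [set i | t <= v i].
  apply: (@bigmax_sup _ _ _ _ A); last by apply/bigmin_geP; split=> // i; rewrite inE.
  rewrite (_ : (fun i => i \in A) = (fun i => t <= v i)) //.
  by apply: funext => i; rewrite inE.
Qed.

Lemma thr_inj (M : nat) (a b : int) :
  - M%:Z <= a <= M%:Z -> - M%:Z <= b <= M%:Z ->
  (forall t, - M%:Z < t <= M%:Z -> (t <= a) = (t <= b)) -> a = b.
Proof.
move=> ha hb H; have Ha := H a; have Hb := H b; lia.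
Qed.

Lemma latextP m n (phi : cube m -> cube n) (M : nat) v w : boxmap phi ->
  (forall j, - M%:Z <= w j <= M%:Z) ->
  (forall t j, - M%:Z < t <= M%:Z -> (t <= w j) = phi (thr t v) j) ->
  latext phi M v = w.
Proof.
move=> phiP wM H; apply: funext => j.
apply: (@thr_inj M) => // [|t tM]; first exact: latext_bound.
by rewrite H // -(@thr_latext _ _ _ M).
Qed.

Definition clamp n (M : nat) (v : vec int n) : vec int n :=
  fun i => Num.max (- M%:Z) (Num.min M%:Z (v i)).

Lemma thr_clamp n (M : nat) (v : vec int n) t : - M%:Z < t <= M%:Z ->
  thr t (clamp M v) = thr t v.
Proof. by move=> tM; apply: funext => i; rewrite /thr /clamp; lia. Qed.

Lemma latext_id n M (v : vec int n) : latext id M v = clamp M v.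
Proof.
apply: latextP => [|j|t j tM]; first exact: boxmap_id.
  by rewrite /clamp; lia.
by rewrite -(thr_clamp v tM).
Qed.

Lemma latext_clamp m n (phi : cube m -> cube n) (M M' : nat) v : boxmap phi ->
  (M <= M')%N -> clamp M (latext phi M' v) = latext phi M v.
Proof.
move=> phiP le_M; symmetry; apply: latextP => // [j|t j tM].
  by rewrite /clamp; lia.
rewrite -[LHS]/(thr t (clamp M _) j) thr_clamp // thr_latext //; lia.
Qed.

Lemma latext_comp l m n (phi : cube m -> cube n) (psi : cube l -> cube m) M v :
  boxmap phi -> boxmap psi ->
  latext (phi \o psi) M v = latext phi M (latext psi M v).
Proof.
move=> phiP psiP; apply: latextP => [|j|t j tM].
- exact: boxmap_comp.
- exact: latext_bound.
- rewrite -[LHS]/(thr t _ j) thr_latext //=; congr (phi _ j).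
  by apply: funext => i; rewrite thr_latext.
Qed.

Lemma latext_tens m n m' n' (phi : cube m -> cube m') (psi : cube n -> cube n') M v :
  boxmap phi -> boxmap psi ->
  latext (ftens phi psi) M v =
  vcat (latext phi M (vleft v)) (latext psi M (vright v)).
Proof.
move=> phiP psiP; apply: latextP => [|j|t j tM].
- exact: boxmap_tens.
- by case: (split_ordP j) => i ->; rewrite ?vcat_lshift ?vcat_rshift;
    exact: latext_bound.
- rewrite /ftens; case: (split_ordP j) => i ->; rewrite ?vcat_lshift ?vcat_rshift;
    by rewrite -[LHS]/(thr t _ i) thr_latext.
Qed.

Lemma clamp_vcat m n M (v : vec int m) (w : vec int n) :
  clamp M (vcat v w) = vcat (clamp M v) (clamp M w).
Proof.
apply: funext => i; case: (split_ordP i) => j ->;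
  by rewrite /clamp ?vcat_lshift ?vcat_rshift.
Qed.

Lemma stable_le G n (f : gmap (gpow Iinf n) G) M M' :
  (M <= M')%N -> stable f M -> stable f M'.
Proof.
move=> le_M fM v i.
have vsetK a b : vset i b (vset i a v) = vset i b v.
  by apply: funext => j; rewrite /vset; case: eqP.
have at_i a : vset i a v i = a by rewrite /vset eqxx.
have {le_M} [<-|lt_M] : M = M' \/ (M < M')%N by lia.
  exact: fM.
split=> h.
- have [h1 _] := fM (vset i M'%:Z v) i; rewrite at_i vsetK in h1.
  by rewrite -h1; [apply: (fM v i).1; lia | lia].
- have [_ h1] := fM (vset i (- M'%:Z) v) i; rewrite at_i vsetK in h1.
  by rewrite -h1; [apply: (fM v i).2; lia | lia].
Qed.

Lemma stable_clamp G n (f : gmap (gpow Iinf n) G) M v :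
  stable f M -> f (clamp M v) = f v.
Proof.
move=> fM; pose w k : vec int n := fun i => if (i < k)%N then clamp M v i else v i.
suff H k : f (w k) = f v.
  rewrite -(H n); congr (gfun f _); apply: funext => i; by rewrite /w ltn_ord.
elim: k => [|k IHk]; first by congr (gfun f _); apply: funext.
rewrite -IHk; case: (ltnP k n) => [lt_kn|le_nk]; last first.
  by congr (gfun f _); apply: funext => i; rewrite /w !ifT //; have := ltn_ord i; lia.
pose i := Ordinal lt_kn.
have wi : w k i = v i by rewrite /w ltnn.
have -> : w k.+1 = vset i (clamp M v i) (w k).
  apply: funext => j; rewrite /w /vset; case: eqP => [->|nj]; first by rewrite ltnSn.
  have {}nj : (j : nat) <> k by move=> e; apply: nj; exact: val_inj.
  by rewrite ltnS leq_eqVlt (_ : (_ == _) = false) //; apply/eqP.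
have [h1 h2] := fM (w k) i; rewrite wi in h1 h2.
case: (ltP M%:Z (v i)) => [lt1|le1].
  by rewrite -(h1 lt1); congr (gfun f (vset i _ _)); rewrite /clamp; lia.
case: (ltP (v i) (- M%:Z)) => [lt2|le2].
  by rewrite -(h2 lt2); congr (gfun f (vset i _ _)); rewrite /clamp; lia.
congr (gfun f _); apply: funext => j; rewrite /vset; case: eqP => // ->.
by rewrite wi /clamp; lia.
Qed.

Lemma stable_latext G m n (f : gmap (gpow Iinf n) G) (phi : cube m -> cube n) M M' v :
  boxmap phi -> stable f M -> (M <= M')%N ->
  f (latext phi M' v) = f (latext phi M v).
Proof. by move=> phiP fM le_M; rewrite -(latext_clamp _ phiP le_M) stable_clamp. Qed.

Lemma latext_adj m n (phi : cube m -> cube n) M v w : boxmap phi ->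
  @adj (gpow Iinf m) v w ->
  @adj (gpow Iinf n) (latext phi M v) (latext phi M w).
Proof.
move=> phiP; rewrite !adj_gpow => -[->|[i [vw e]]]; first by left.
wlog vwi : v w vw e / w i = v i + 1.
  move=> W; case: vw => [eq_i|[h|h]].
  - left; congr (latext _ _ _); apply: funext => j.
    by case: (eqVneq j i) => [->|/e].
  - by apply: W => //; right; left.
  - apply: pow_rel_sym; apply: W => //; first by right; left.
    by move=> j /e.
have thr_eq t : t != w i -> thr t v = thr t w.
  move=> nt; apply: funext => j; rewrite /thr.
  by case: (eqVneq j i) => [->|/e->] //; lia.
have thr_ne j : j != i -> thr (w i) v j = thr (w i) w j.
  by move=> /e; rewrite /thr => ->.
have lat_thr j t : - M%:Z < t <= M%:Z -> t != w i ->
    (t <= latext phi M v j) = (t <= latext phi M w j).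
  move=> tM nt; rewrite -[LHS]/(thr t _ j) -[RHS]/(thr t _ j).
  by rewrite !thr_latext // thr_eq.
have lat_eq j : phi (thr (w i) v) j = phi (thr (w i) w) j ->
    latext phi M v j = latext phi M w j.
  move=> ej; apply: (@thr_inj M); try exact: latext_bound.
  move=> t tM; case: (eqVneq t (w i)) => [et|]; last exact: lat_thr.
  by subst t; rewrite -[LHS]/(thr _ _ j) -[RHS]/(thr _ _ j) !thr_latext.
case: (boxmap_flip phiP thr_ne) => [ephi|[j ephi]].
  by left; apply: funext => k; apply: lat_eq; rewrite ephi.
right; exists j; split; last by move=> k /ephi /lat_eq.
have := lat_thr j; have := latext_bound phi M v j; have := latext_bound phi M w j.
set a := latext phi M v j; set b := latext phi M w j => hb ha H.
have Ha := H a; have Hb := H b; have Ha1 := H (a + 1); have Hb1 := H (b + 1).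
have : a = b \/ b = a + 1 \/ a = b + 1 by lia.
by case=> [|h]; [left | right].
Qed.

Definition nbound G n (f : ncube G n) : nat := projT1 (cid (ncubeP f)).

Lemma nboundP G n (f : ncube G n) : stable f (nbound f).
Proof. exact: projT2 (cid (ncubeP f)). Qed.

Definition nact_gmap G m n (p : box m n) (f : ncube G n) : gmap (gpow Iinf m) G :=
  @GMap (gpow Iinf m) G (fun v => f (latext p (nbound f) v))
    (fun v w vw => gfunP f (latext_adj (nbound f) (bfunP p) vw)).

Lemma nact_stable G m n (p : box m n) (f : ncube G n) M :
  stable f M -> stable (nact_gmap p f) M.
Proof.
move=> fM; have E v : f (latext p (nbound f) v) = f (latext p M v).
  have [fb pP] := (nboundP f, bfunP p).
  by case/orP: (leq_total (nbound f) M) => le_M;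
    rewrite ?(stable_latext _ pP fb le_M) // (stable_latext _ pP fM le_M).
move=> v i; split=> h; rewrite /= !E; congr (gfun f _);
  apply: latextP => [||t j tM]; try exact: bfunP; try exact: latext_bound;
  rewrite -[LHS]/(thr t _ j) thr_latext //; try exact: bfunP;
  congr (bfun p _ j); apply: funext => k; rewrite /thr /vset;
  by case: eqP => // ->; lia.
Qed.

Definition nact G m n (p : box m n) (f : ncube G n) : ncube G m :=
  NCube (ex_intro _ _ (nact_stable p (nboundP f))).

Lemma nactE G m n (p : box m n) (f : ncube G n) M v :
  stable f M -> nact p f v = f (latext p M v).
Proof.
move=> fM; have [fb pP] := (nboundP f, bfunP p); rewrite /=.
by case/orP: (leq_total (nbound f) M) => le_M;
  rewrite ?(stable_latext _ pP fb le_M) // (stable_latext _ pP fM le_M).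
Qed.

Fact nact_id G n (f : ncube G n) : nact (bid n) f = f.
Proof. by apply: ncube_ext => v /=; rewrite latext_id stable_clamp //; exact: nboundP. Qed.

Fact nact_comp G l m n (p : box m n) (q : box l m) (f : ncube G n) :
  nact (bcomp p q) f = nact q (nact p f).
Proof.
apply: ncube_ext => v; have fM := nboundP f.
rewrite (nactE _ _ fM) (@nactE _ _ _ q (nact p f) _ v (nact_stable p fM)) (nactE _ _ fM) /=.
by rewrite latext_comp //; exact: bfunP.
Qed.

Definition nerve (G : graph) : cset :=
  @CSet (ncube G) (@nact G) (@nact_id G) (@nact_comp G).

Lemma nact_face G n (i : 'I_n.+1) (e : bool) (f : ncube G n.+1) M (v : vec int n) :
  stable f M -> nact (bface i e) f v = f (vins i (if e then M%:Z else - M%:Z) v).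
Proof.
move=> fM; rewrite (nactE _ _ fM) -[RHS](stable_clamp _ fM); congr (gfun f _).
apply: latextP => [|j|t j tM]; [exact: bfunP | by rewrite /clamp; lia |].
rewrite -[LHS]/(thr t (clamp M _) j) thr_clamp // /thr /= /vins.
by case: unlift => // ; case: e; lia.
Qed.

Lemma nact_degen G n (i : 'I_n.+1) (f : ncube G n) (v : vec int n.+1) :
  nact (bdegen i) f v = f (vdel i v).
Proof.
have fM := nboundP f; rewrite -[RHS](stable_clamp _ fM); congr (gfun f _).
apply: latextP => [|j|t j tM]; [exact: bfunP | by rewrite /clamp; lia |].
by rewrite -[LHS]/(thr t (clamp _ _) j) thr_clamp.
Qed.

Lemma nact_conn G n (i : 'I_n) (e : bool) (f : ncube G n) (v : vec int n.+1) :
  nact (bgamma i e) f v = f (vjoin (if e then Num.min else Num.max) i v).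
Proof.
have fM := nboundP f; rewrite -[RHS](stable_clamp _ fM); congr (gfun f _).
apply: latextP => [|j|t j tM]; [exact: bfunP | by rewrite /clamp; lia |].
rewrite -[LHS]/(thr t (clamp _ _) j) thr_clamp // /thr /= /vjoin.
by case: ifP => // _; case: ifP => // _; case: e => /=; lia.
Qed.

Lemma nact_cast G m n (e : m = n) (f : ncube G n) (v : vec int m) :
  nact (bcast e) f v = f (vcast e v).
Proof.
case: n / e f => f; rewrite (_ : bcast _ = bid m).
  rewrite nact_id; congr (gfun f _); apply: funext => i; rewrite /vcast.
  exact: vec_eta_ord.
by apply: box_ext => x; apply: funext => i; rewrite /= /vcast; exact: vec_eta_ord.
Qed.

Fact nmap_stable (G H : graph) n (k : gmap G H) (f : ncube G n) :
  exists M, stable (gcomp k f) M.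
Proof.
by exists (nbound f) => v i; have [h1 h2] := nboundP f v i;
  split=> h /=; rewrite ?h1 ?h2.
Qed.

Definition nmap_cell (G H : graph) (k : gmap G H) n (f : ncube G n) : ncube H n :=
  NCube (nmap_stable k f).

Fact nmap_nat (G H : graph) (k : gmap G H) m n (p : box m n) (f : nerve G n) :
  nmap_cell k (act p f) = act p (nmap_cell k f : nerve H n).
Proof.
apply: ncube_ext => v; rewrite [RHS](@nactE _ _ _ _ _ (nbound f)) //.
by move=> w i; have [h1 h2] := nboundP f w i; split=> h /=; rewrite ?h1 ?h2.
Qed.

Definition nmap (G H : graph) (k : gmap G H) : cmap (nerve G) (nerve H) :=
  @CMap (nerve G) (nerve H) (@nmap_cell G H k) (@nmap_nat G H k).

Fact otimes_adj (G H : graph) m n (f : gmap (gpow Iinf m) G) (g : gmap (gpow Iinf n) H)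
    (v w : gpow Iinf (m + n)) :
  adj v w -> @adj (gprod G H) (f (vleft v), g (vright v)) (f (vleft w), g (vright w)).
Proof.
rewrite adj_gpow adj_gprod /prod_rel /= => -[->|[i [a e]]].
  by left; split=> //; exact: adj_refl.
case: (split_ordP i) => j ej; subst i; [right | left]; split.
- congr (gfun g _); apply: funext => k; apply: e.
  by apply/eqP => /(congr1 val) /=; have := ltn_ord j; lia.
- apply: gfunP; apply/adj_gpow; right; exists j; split=> // k nk; apply: e.
  by apply: contra nk => /eqP/(congr1 val) /= h; apply/eqP/val_inj.
- congr (gfun f _); apply: funext => k; apply: e.
  by apply/eqP => /(congr1 val) /=; have := ltn_ord k; lia.
- apply: gfunP; apply/adj_gpow; right; exists j; split=> // k nk; apply: e.
  by apply: contra nk => /eqP/(congr1 val) /= h; apply/eqP/val_inj => /=; lia.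
Qed.

Definition otimes_gmap (G H : graph) m n (f : gmap (gpow Iinf m) G)
    (g : gmap (gpow Iinf n) H) : gmap (gpow Iinf (m + n)) (gprod G H) :=
  @GMap (gpow Iinf (m + n)) (gprod G H) (fun v => (f (vleft v), g (vright v)))
        (@otimes_adj G H m n f g).

Lemma otimes_stable (G H : graph) m n (f : gmap (gpow Iinf m) G)
    (g : gmap (gpow Iinf n) H) M :
  stable f M -> stable g M -> stable (otimes_gmap f g) M.
Proof.
move=> fM gM v i.
have vl a j : vleft (vset (lshift n j) a v) = vset j a (vleft v).
  by apply: funext => k; rewrite /vset /vleft (inj_eq (@lshift_inj _ _)).
have vr a j : vright (vset (lshift n j) a v) = vright v.
  by apply: funext => k; rewrite /vset /vright eq_rlshift.
have rl a j : vleft (vset (rshift m j) a v) = vleft v.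
  by apply: funext => k; rewrite /vset /vleft eq_lrshift.
have rr a j : vright (vset (rshift m j) a v) = vset j a (vright v).
  by apply: funext => k; rewrite /vset /vright (inj_eq (@rshift_inj _ _)).
case: (split_ordP i) => j -> /=; rewrite ?vl ?vr ?rl ?rr.
  have [h1 h2] := fM (vleft v) j.
  by split=> h; rewrite /= ?vl ?vr ?h1 ?h2.
have [h1 h2] := gM (vright v) j.
by split=> h; rewrite /= ?rl ?rr ?h1 ?h2.
Qed.

Fact otimes_bound (G H : graph) m n (f : ncube G m) (g : ncube H n) :
  exists M, stable (otimes_gmap f g) M.
Proof.
exists (maxn (nbound f) (nbound g)); apply: otimes_stable.
  by apply: stable_le (nboundP f); exact: leq_maxl.
by apply: stable_le (nboundP g); exact: leq_maxr.
Qed.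

Definition otimes (G H : graph) m n (f : nerve G m) (g : nerve H n) :
  nerve (gprod G H) (m + n)%N := NCube (otimes_bound f g).

Fact otimes_nat (G H : graph) m n m' n' (p : box m m') (q : box n n')
    (f : nerve G m') (g : nerve H n') :
  otimes (act p f) (act q g) = act (btens p q) (otimes f g).
Proof.
apply: ncube_ext => v; pose M := maxn (nbound f) (nbound g).
have fM : stable f M by apply: stable_le (nboundP f); exact: leq_maxl.
have gM : stable g M by apply: stable_le (nboundP g); exact: leq_maxr.
rewrite [RHS](@nactE _ _ _ _ _ M); last exact: otimes_stable.
rewrite /= latext_tens; try exact: bfunP.
rewrite vleft_cat vright_cat; congr pair.
  exact: (nactE p _ fM).
exact: (nactE q _ gM).
Qed.

Definition nlax (G H : graph) :
    cmap (tensor (nerve G) (nerve H)) (nerve (gprod G H)) :=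
  tensor_rec (@BiMap (nerve G) (nerve H) (nerve (gprod G H)) (@otimes G H)
                     (@otimes_nat G H)).

Definition gconst (G H : graph) (h : H) : gmap G H :=
  @GMap G H (fun _ => h) (fun _ _ _ => adj_refl h).

Definition I0_cell n : ncube I0 n :=
  @NCube I0 n (gconst _ (tt : I0)) (ex_intro _ 0%N (fun v i => conj (fun _ => erefl) (fun _ => erefl))).

Lemma I0_cellP n (f : ncube I0 n) : f = I0_cell n.
Proof. by apply: ncube_ext => v /=; case: (f v). Qed.

Fact nunit_nat m n (p : box m n) (x : repr 0 n) :
  I0_cell m = act p (I0_cell n : nerve I0 n).
Proof. exact: esym (I0_cellP _). Qed.

Definition nunit : cmap (repr 0) (nerve I0) :=
  @CMap (repr 0) (nerve I0) (fun n _ => I0_cell n) nunit_nat.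

Lemma nunit_bij n : bijective (nunit n).
Proof.
have bz : boxmap (fun (_ : cube n) => (fun=> false) : cube 0).
  elim: n => [|n IHn].
    rewrite (_ : (fun _ => _) = id); first exact: boxmap_id.
    by apply: funext => x; exact: vec0_eq.
  exact: boxmap_comp IHn (boxmap_degen ord0).
exists (fun=> Box bz) => [x|f]; last exact: esym (I0_cellP f).
by apply: box_ext => v; exact: vec0_eq.
Qed.

Fact gcomp_adj (G H J : graph) (p q : gprod (ghom H J) (ghom G H)) :
  adj p q -> @adj (ghom G J) (gcomp p.1 p.2) (gcomp q.1 q.2).
Proof.
rewrite adj_gprod adj_ghom => -[[-> /adj_ghom a]|[-> /adj_ghom a]] v /=.
  by apply: gfunP; exact: a.
exact: a.
Qed.

Definition gcomp_map (G H J : graph) :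
    gmap (gprod (ghom H J) (ghom G H)) (ghom G J) :=
  @GMap (gprod (ghom H J) (ghom G H)) (ghom G J)
        (fun p => gcomp p.1 p.2) (@gcomp_adj G H J).

Definition Gcomp (G H J : graph) :
    cmap (tensor (nerve (ghom H J)) (nerve (ghom G H))) (nerve (ghom G J)) :=
  cmap_comp (nmap (gcomp_map G H J)) (nlax (ghom H J) (ghom G H)).

Definition Gid (G : graph) : cmap (repr 0) (nerve (ghom G G)) :=
  cmap_comp (nmap (gconst I0 (gid G : ghom G G))) nunit.

Lemma tensor_mapE X Y X' Y' (f : cmap X X') (g : cmap Y Y') m n (x : X m) (y : Y n) :
  tensor_map f g _ (tpair X Y _ _ x y) = tpair X' Y' _ _ (f m x) (g n y).
Proof. exact: tensor_recE. Qed.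

Lemma tassocE (X Y W : cset) l m n (x : X l) (y : Y m) (w : W n) :
  tassoc X Y W _ (tpair (tensor X Y) W _ _ (tpair X Y _ _ x y) w) =
  act (bassoc l m n) (tpair X (tensor Y W) _ _ x (tpair Y W _ _ y w)).
Proof.
rewrite /tassoc tensor_recE [LHS]tassoc_funE /tassoc_cell /= -/(tensor_act _ _).
congr (tensor_act _ _); apply: box_ext => v /=.
by rewrite /ftens vcat_split.
Qed.

Lemma GcompE (G H J : graph) m n (g : nerve (ghom H J) m) (f : nerve (ghom G H) n) :
  Gcomp G H J _ (tpair _ _ _ _ g f) = nmap_cell (gcomp_map G H J) (otimes g f).
Proof.
exact: (congr1 (nmap (gcomp_map G H J) _)
          (tensor_recE (BiMap (@otimes_nat (ghom H J) (ghom G H))) g f)).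
Qed.

Lemma tensor_ext3 (X Y W Z : cset) (f g : cmap (tensor (tensor X Y) W) Z) :
  (forall l m n (x : X l) (y : Y m) (w : W n),
    f _ (tpair _ _ _ _ (tpair _ _ _ _ x y) w) =
    g _ (tpair _ _ _ _ (tpair _ _ _ _ x y) w)) ->
  f = g.
Proof.
move=> fg; apply: tensor_ext => k n c w.
have [l [m [x [y [r ->]]]]] := tensor_ind c.
by rewrite -[w]act_id bimapP !cfunP fg.
Qed.

Fact GcompA (G H J K : graph) :
  cmap_comp (Gcomp G H K) (tensor_map (Gcomp H J K) (cmap_id (nerve (ghom G H)))) =
  cmap_comp (cmap_comp (Gcomp G J K)
                       (tensor_map (cmap_id (nerve (ghom J K))) (Gcomp G H J)))
            (tassoc (nerve (ghom J K)) (nerve (ghom H J)) (nerve (ghom G H))).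
Proof.
apply: tensor_ext3 => l m n h g f.
rewrite (cmap_compE (Gcomp G H K)) (cmap_compE (cmap_comp _ _)).
rewrite (cmap_compE (Gcomp G J K)) tassocE tensor_mapE cmap_idE !GcompE.
rewrite (cfunP (tensor_map _ _)) tensor_mapE cmap_idE (cfunP (Gcomp _ _ _)) !GcompE.
apply: ncube_ext => v; rewrite [RHS]nact_cast; apply: gmap_ext => u /=.
by rewrite vassoc_l vassoc_m vassoc_r.
Qed.

Fact Gcomp1l (G H : graph) :
  cmap_comp (Gcomp G H H) (tensor_map (Gid H) (cmap_id (nerve (ghom G H)))) =
  tunitl (nerve (ghom G H)).
Proof.
apply: tensor_ext => m n u f.
rewrite (cmap_compE (Gcomp G H H)) tensor_mapE cmap_idE GcompE.
rewrite [RHS]tensor_recE; apply: ncube_ext => v; have fM := nboundP f.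
rewrite [RHS](@nactE _ _ _ (btens u (bid n)) f _ _ fM) latext_tens; try exact: bfunP.
rewrite vcat0l latext_id stable_clamp //.
exact: gmap_ext.
Qed.

Fact Gcomp1r (G H : graph) :
  cmap_comp (Gcomp G G H) (tensor_map (cmap_id (nerve (ghom G H))) (Gid G)) =
  tunitr (nerve (ghom G H)).
Proof.
apply: tensor_ext => m n f u.
rewrite (cmap_compE (Gcomp G G H)) tensor_mapE cmap_idE GcompE.
rewrite [RHS]tensor_recE; apply: ncube_ext => v.
rewrite [RHS](congr1 (fun h : ncube _ _ => h v) (nact_comp _ _ _)).
set g := nact (bcast _) f; have gM := nboundP g.
rewrite [RHS](nactE _ _ gM) latext_tens; try exact: bfunP.
rewrite latext_id (_ : latext u _ _ = clamp (nbound g) (fun=> 0)); last exact: vec0_eq.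
rewrite -clamp_vcat stable_clamp // nact_cast vcast_cat0.
exact: gmap_ext.
Qed.

Definition Graph_box : ecat :=
  @ECat graph (fun G H => nerve (ghom G H)) Gcomp Gid
        (fun G H J K => @GcompA G H J K) Gcomp1l Gcomp1r.

(* Main.v *)
From mathcomp Require Import all_boot all_order all_algebra.
From mathcomp Require Import boolp zify.
Require Import Defs.

Set Implicit Arguments.
Unset Strict Implicit.
Unset Printing Implicit Defensive.
Import Order.TTheory GRing.Theory Num.Theory.

Local Open Scope ring_scope.

(** The morphism objects are nerves, and the nerve of every graph is a Kan
    complex ([nerve_kan]).

    An open box in the nerve is a compatible family of maps on the walls
    v_j = +M or v_j = -M of the box [-M, M]^n, all walls except one, say the
    one in direction i at the end e; M is chosen to bound the stability of
    all these maps.  The maps glue to a function K on the union U of the given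
    walls, and K is a graph map on each wall.  It suffices to find a map
    [retr] from Z^n to U which is the clamping onto [-M, M]^n on the given
    walls of a larger box, and which sends two adjacent points to adjacent
    points of one common wall.  Then K composed with [retr] fills the box.

    Over the reals one would project [-M, M]^n radially onto U from a point
    above the missing wall, but on the grid this may move two coordinates at
    once.  The remedy is to spread the deformation over a collar of width 2M.
    Let r(v) >= M be the maximum of M and of the |v_k| with k != i.  [retr]
    clamps v to [-M, M]^n, and then moves coordinate i towards the wall opposite
    to the missing one, to a distance of at most r(v) - M from it.  Where
    r(v) = M the result lies on that opposite wall; in the collar, some |v_k|
    exceeds M, so the result lies on a wall of direction k.
    A step that changes r(v) takes place in a coordinate k that is outside
    [-M, M] at one end and at least M in absolute value at the other, so
    clamping hides it and only coordinate i of the result moves.  This is why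
    at most one coordinate changes ([retr_adj]).  As soon as r(v) >= 3M the
    truncation of coordinate i is void ([retr_clamp]), which gives both the
    stability at 3M and the prescribed faces. *)

Definition side (M : nat) (d : bool) : int := if d then M%:Z else - M%:Z.

Definition radius n (i : 'I_n) (M : nat) (v : vec int n) : int :=
  \big[Num.max/M%:Z]_(k | k != i) `|v k|.

Lemma radius_ge n (i : 'I_n) M v : M%:Z <= radius i M v.
Proof. exact: bigmax_ge_id. Qed.

Lemma norm_le_radius n (i : 'I_n) M v k : k != i -> `|v k| <= radius i M v.
Proof. by move=> ki; exact: (le_bigmax_cond _ (fun k => `|v k|)). Qed.

Lemma radius_attained n (i : 'I_n) M v : M%:Z < radius i M v ->
  exists2 k, k != i & `|v k| = radius i M v.
Proof.
rewrite /radius; elim/big_rec: _ => [|k r ki IH]; first by rewrite ltxx.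
case: (leP `|v k| r) => _ hr; [exact: IH | by exists k].
Qed.

(** Writing r for the radius, coordinate i is kept within r - M of the wall
    opposite to the missing wall (i, e): that is the bound -M + (r - M) from
    above when e is the upper end, and M - (r - M) from below otherwise. *)
Definition retr n (i : 'I_n) (e : bool) (M : nat) (v : vec int n) : vec int n :=
  fun k => if k == i then
      let r := radius i M v in
      if e then Num.min (clamp M v i) (r - 2 * M%:Z)
      else Num.max (clamp M v i) (2 * M%:Z - r)
    else clamp M v k.

(** Coordinate i of a clamped point is at distance at most 2M from the wall
    opposite to the missing one, so a radius of 3M leaves it alone; in the
    second case this distance is already 0. *)
Lemma retr_clamp n (i : 'I_n) e M v :
  (3 * M)%:Z <= radius i M v \/ v i = side (3 * M) (~~ e) ->
  retr i e M v = clamp M v.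
Proof.
move=> h; apply: funext => k; rewrite /retr; case: eqP => // ->.
have := radius_ge i M v; rewrite /clamp; case: h; case: e; rewrite /side /=; lia.
Qed.

Lemma retr_eq n (i : 'I_n) e M v w :
  clamp M v = clamp M w ->
  radius i M v = radius i M w \/
    (3 * M)%:Z <= radius i M v /\ (3 * M)%:Z <= radius i M w ->
  retr i e M v = retr i e M w.
Proof.
move=> ec [er|[rv rw]]; last by rewrite !retr_clamp //; left.
by apply: funext => k; rewrite /retr ec er.
Qed.

(** If k = i, the radius does not depend on v_k.  Otherwise it may change, but
    it is at least 3M before and after. *)
Lemma retr_stable n (i : 'I_n) e M v k d :
  (if d then (3 * M)%:Z <= v k else v k <= - (3 * M)%:Z) ->
  retr i e M (vset k (side (3 * M) d) v) = retr i e M v.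
Proof.
move=> hk; apply: retr_eq.
  apply: funext => l; rewrite /clamp /vset; case: eqP => // ->.
  by move: hk; rewrite /side; case: d; lia.
case: (eqVneq k i) => [->|ki].
  by left; apply: eq_bigr => l /negbTE li; rewrite /vset li.
right; have := norm_le_radius M v ki.
have := norm_le_radius M (vset k (side (3 * M) d) v) ki.
by move: hk; rewrite /vset eqxx /side; case: d; lia.
Qed.

(** The common wall is the one opposite to the missing wall when both radii are
    M.  Otherwise it is the wall of a coordinate j realising the larger radius:
    if the step is in direction j then both ends are clamped to the same point
    of that wall and only the radius moves coordinate i; if it is not, then the
    two radii agree. *)
Lemma retr_adj n (i : 'I_n) e M (v w : gpow Iinf n) : adj v w ->
  exists j d, [/\ (j, d) != (i, e), retr i e M v j = side M d,
    retr i e M w j = side M d &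
    @adj (gpow Iinf n) (retr i e M v) (retr i e M w)].
Proof.
wlog le_r : v w / radius i M v <= radius i M w.
  move=> W vw; case: (leP (radius i M v) (radius i M w)) => [/W|/ltW/W]; first exact.
  by move=> /(_ (adj_sym vw)) [j [d [ne rw rv a]]]; exists j, d; split=> //; exact: adj_sym.
have := radius_ge i M v => rv.
move=> /adj_gpow vw.
(* adjacency as an unoriented step in direction k, or no step at all *)
have {}vw : exists k, `|v k - w k| <= 1 /\ forall l, l != k -> v l = w l.
  case: vw => [->|[k [a /= vw]]]; first by exists i; split=> //; lia.
  by exists k; split=> //; move: a => /= [->|[|]] /=; lia.
case: vw => k [vwk vw].
have adjI (x y : gpow Iinf n) l : `|x l - y l| <= 1 ->
    (forall l', l' != l -> x l' = y l') -> adj x y.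
  move=> xyl xy; apply/adj_gpow; right; exists l; split=> //.
  have : x l = y l \/ y l = x l + 1 \/ x l = y l + 1 by lia.
  by case=> [|h]; [left | right].
case: (leP (radius i M w) M%:Z) => [rw|rw].
  exists i, (~~ e); split.
  - by rewrite xpair_eqE eqxx; case: (e).
  - by rewrite /retr eqxx /clamp /side; case: (e) => /=; lia.
  - by rewrite /retr eqxx /clamp /side; case: (e) => /=; lia.
  - apply: (adjI _ _ k) => [|l lk]; rewrite /retr.
      by case: eqP => ?; rewrite /clamp; case: (e); lia.
    case: eqP => [el|_]; rewrite /clamp; last by rewrite (vw _ lk).
    by have vi := vw _ lk; rewrite el in vi; rewrite vi; case: (e); lia.
have [j ji rj] := radius_attained rw.
have vj : clamp M v j = clamp M w j.
  rewrite /clamp; case: (eqVneq j k) => [jk|/vw-> //]; subst k; lia.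
have rvj := norm_le_radius M v ji.
exists j, (0 < w j); split.
- by rewrite xpair_eqE (negbTE ji).
- by rewrite /retr (negbTE ji) vj /clamp /side; case: ifP; lia.
- by rewrite /retr (negbTE ji) /clamp /side; case: ifP; lia.
case: (eqVneq j k) => jk.
  subst k; apply: (adjI _ _ i) => [|l /negbTE li]; rewrite /retr.
    rewrite eqxx /clamp (vw i) 1?eq_sym //; case: (e); lia.
  by rewrite li; case: (eqVneq l j) => [->|lj] //; rewrite /clamp vw.
have er : radius i M v = radius i M w by move: rvj; rewrite vw //; lia.
apply: (adjI _ _ k) => [|l lk]; rewrite /retr er.
  by case: eqP => [<-|_]; rewrite /clamp; case: (e); lia.
case: eqP => [<-|_]; rewrite /clamp (vw _ lk) //.
Qed.

(** The idempotent endomorphism that projects the cube onto its face (j, d).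
    Restricting along it turns a map on a wall into a map on the whole cube, so
    that compatibility of walls can be expressed without renumbering the
    coordinates of faces of faces. *)
Definition bwall n (j : 'I_n.+1) (d : bool) : box n.+1 n.+1 :=
  bcomp (bface j d) (bdegen j).

Lemma vins_vdel T n (j : 'I_n.+1) (a : T) (v : vec T n.+1) :
  vins j a (vdel j v) = vset j a v.
Proof.
apply: funext => k; rewrite /vset; case: (unliftP j k) => [k'|] ->.
  by rewrite vins_lift eq_sym (negbTE (neq_lift _ _)).
by rewrite vins_at eqxx.
Qed.

Lemma nact_wall G n (j : 'I_n.+1) d (f : ncube G n.+1) M v :
  stable f M -> nact (bwall j d) f v = f (vset j (side M d) v).
Proof. by move=> fM; rewrite nact_comp nact_degen (nact_face _ _ _ fM) vins_vdel. Qed.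

Lemma bwall_face n (j : 'I_n.+1) d : bcomp (bwall j d) (bface j d) = bface j d.
Proof.
apply: box_ext => x /=; congr (vins j d).
by apply: funext => k; rewrite /vdel vins_lift.
Qed.

Lemma bwallC n (j k : 'I_n.+1) c d : j != k ->
  bcomp (bwall j c) (bwall k d) = bcomp (bwall k d) (bwall j c).
Proof.
move=> jk; apply: box_ext => x; rewrite /= !vins_vdel; apply: funext => l.
by rewrite /vset; case: (eqVneq l j) => [->|//]; rewrite (negbTE jk).
Qed.

(** The map P (j, d) stands for the given face (j, d), extended constantly in
    direction j; the hypothesis says that two such maps agree where their walls
    meet. *)
Lemma glue_walls G n (i : 'I_n.+1) e (P : 'I_n.+1 * bool -> ncube G n.+1) :
  (forall j c k d, (j, c) <> (i, e) -> (k, d) <> (i, e) -> j != k ->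
     nact (bwall k d) (P (j, c)) = nact (bwall j c) (P (k, d))) ->
  exists F : ncube G n.+1, forall j d, (j, d) <> (i, e) ->
    nact (bface j d) F = nact (bface j d) (P (j, d)).
Proof.
move=> PC.
(* M is positive so that the two walls of one direction are disjoint *)
have [M [M0 PM]] : exists M, (0 < M)%N /\ forall jd, stable (P jd) M.
  exists (\max_jd nbound (P jd)).+1; split=> // jd.
  apply: stable_le (nboundP (P jd)); apply: leqW.
  exact: (leq_bigmax (F := fun jd => nbound (P jd))).
pose on_wall (w : vec int n.+1) (jd : 'I_n.+1 * bool) :=
  (jd != (i, e)) && (w jd.1 == side M jd.2).
(* Off the union of the walls, K takes the values of a wall that is never the
   missing one. *)
pose K (w : vec int n.+1) := P (odflt (i, ~~ e) [pick jd | on_wall w jd]) w.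
have KE w j d : (j, d) != (i, e) -> w j = side M d -> K w = P (j, d) w.
  move=> ne wj; rewrite /K; case: pickP => [[k c] /= /andP[/= ne' /eqP wk]|]; last first.
    by move=> /(_ (j, d)); rewrite /on_wall ne /= wj eqxx.
  case: (eqVneq k j) => [kj|kj].
    subst k; congr (gfun (P (_, _)) _); move: wj; rewrite wk /side.
    by case: c {ne' wk}; case: d {ne}; lia.
  have /(congr1 (fun f : ncube G n.+1 => f w)) := PC _ _ _ _ (elimN eqP ne') (elimN eqP ne) kj.
  have vsetE (x : 'I_n.+1) b : w x = side M b -> vset x (side M b) w = w.
    by move=> wx; apply: funext => y; rewrite /vset; case: eqP => // ->.
  by rewrite !(nact_wall _ _ _ (PM _)) !vsetE.
have Kadj (v w : gpow Iinf n.+1) : adj v w -> adj (K (retr i e M v)) (K (retr i e M w)).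
  move=> /(retr_adj i e M) [j [d [ne vj wj a]]].
  by rewrite !(KE _ _ _ ne) //; exact: gfunP.
pose F0 : gmap (gpow Iinf n.+1) G := @GMap (gpow Iinf n.+1) G _ Kadj.
have F0M : stable F0 (3 * M).
  move=> v k; split=> h; congr K; rewrite -[LHS]/(retr _ _ _ _).
    exact: (@retr_stable _ _ _ _ _ _ true) (ltW h).
  exact: (@retr_stable _ _ _ _ _ _ false) (ltW h).
exists (NCube (ex_intro _ _ F0M)) => j d ne; apply: ncube_ext => v.
rewrite (@nact_face _ _ _ _ (NCube _) (3 * M) _ F0M).
rewrite (@nact_face _ _ _ _ (P (j, d)) (3 * M)); last first.
  by apply: stable_le (PM _); lia.
rewrite -/(side _ _) /=; set w := vins _ _ v.
have wj : w j = side (3 * M) d by rewrite /w vins_at.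
rewrite retr_clamp; last first.
  case: (eqVneq j i) => [ji|ji]; [right|left].
    rewrite -ji wj; subst j; congr side.
    by case: (eqVneq d e) => [de|]; [case: ne; rewrite de | case: (d) (e) => -[]].
  by apply: le_trans (norm_le_radius M w ji); rewrite wj /side; case: (d); lia.
rewrite (KE _ j d); first exact: stable_clamp.
  exact/eqP.
by rewrite /clamp wj /side; case: (d); lia.
Qed.

(** The family to glue is made of the values of h on the cells [bwall j d] of
    the open box.  By the Yoneda lemma the filling F is a map out of the whole
    cube, and it extends h because every cell of the open box factors through
    a face where F and h agree. *)
Theorem nerve_kan (G : graph) : kan (nerve G).
Proof.
move=> n i e h.
have faceP m (q : box m n) j d : (j, d) <> (i, e) -> in_open_box i e (bcomp (bface j d) q).
  by move=> ne; exists j, d, q.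
pose cell m q j d ne : open_box i e m := exist _ _ (@faceP m q j d ne).
have /choice [P PE] : forall jd, exists f : ncube G n.+1,
    forall ne : (jd.1, jd.2) <> (i, e), f = h _ (cell _ (bdegen jd.1) _ _ ne).
  (* at the missing wall any value will do; that of the opposite wall is used *)
  move=> [j d] /=; case: (pselect ((j, d) = (i, e))) => [jd|ne].
    have ne : (i, ~~ e) <> (i, e) by case; case: (e).
    by exists (h _ (cell _ (bdegen i) _ _ ne)) => ne'; case: (ne' jd).
  exists (h _ (cell _ (bdegen j) _ _ ne)) => ne'; congr (h _ _).
  exact: open_box_ext.
have hE m n' (p : box m n') (x : open_box i e n') : nact p (h n' x) = h m (act p x).
  by rewrite cfunP.
have [|F FE] := @glue_walls G n i e P.
  move=> j c k d nj nk jk; rewrite (PE (j, c) nj) (PE (k, d) nk) !hE.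
  by congr (h _ _); apply: open_box_ext; exact: bwallC.
exists (@CMap (repr n.+1) (nerve G) (fun m p => nact p F)
  (fun l m q p => nact_comp p q F)).
apply: cmap_ext => m [p pP] /=; have [j [d [q [ne ep]]]] := pP; subst p.
rewrite nact_comp FE // (PE (j, d) ne) !hE; congr (h _ _); apply: open_box_ext => /=.
by rewrite bwall_face.
Qed.

Theorem theorem5p36 : locally_kan Graph_box.
Proof. by move=> G H; exact: nerve_kan. Qed.
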